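(* For any cardinal $\kappa\ge\omega$ and natural numbers $m,\ell$ with $\ell>0$, $w\chi_{\rm CF}(\beth_m(\kappa),\kappa,2\ell+1)\ge (m+1)\cdot\ell+1$.
   Context: $\beth_0(\kappa)=\kappa$, $\beth_{r+1}(\kappa)=2^{\beth_r(\kappa)}$. A weak conflict free coloring of a family $\mathcal A$ with $\rho$ colors is a function $f$ with $\operatorname{dom}(f)\subseteq\bigcup\mathcal A$, values in $\rho$, such that every $A\in\mathcal A$ has some $\zeta$ with $|A\cap f^{-1}\{\zeta\}|=1$; $w\chi_{\rm CF}(\mathcal A)$ is the least such $\rho$. A $(\lambda,\kappa,\mu)$-system is a family of $\lambda$ sets each of size $\kappa$, distinct members meeting in fewer than $\mu$ points; $w\chi_{\rm CF}(\lambda,\kappa,\mu)$ is the supremum of $w\chi_{\rm CF}(\mathcal A)$ over all $(\lambda,\kappa,\mu)$-systems. *)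

(* Defs.v *)
(* cardinals are modelled as types up to bijection. *)
From mathcomp Require Import all_boot.
Set Implicit Arguments. Unset Strict Implicit. Unset Printing Implicit Defensive.

Definition equipotent (T U : Type) : Prop :=
  exists f : T -> U, bijective f.

Definition infinite_type (T : Type) : Prop :=
  exists f : nat -> T, injective f.

Fixpoint beth (K : Type) (r : nat) : Type :=
  match r with
  | 0 => K
  | r'.+1 => beth K r' -> Prop
  end.

Definition card_lt {X : Type} (S : X -> Prop) (mu : nat) : Prop :=
  exists s : seq X, size s < mu /\ forall x, S x -> exists2 i, i < size s & x = nth x s i.

Definition is_system (I K X : Type) (A : I -> X -> Prop) (mu : nat) : Prop :=
  injective A /\
  (forall i, equipotent {x : X | A i x} K) /\
  (forall i j, i <> j -> card_lt (fun x => A i x /\ A j x) mu).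

(* f : X -> option rho is a partial function (None = undefined) with values in rho;
   it is a weak conflict free colouring of A. *)
Definition weak_CF_coloring (I X rho : Type) (A : I -> X -> Prop)
    (f : X -> option rho) : Prop :=
  forall i, exists z : rho, exists x, A i x /\ f x = Some z /\
     forall y, A i y -> f y = Some z -> y = x.

Definition wCF_colorable (I X : Type) (A : I -> X -> Prop) (k : nat) : Prop :=
  exists f : X -> option 'I_k, weak_CF_coloring A f.

Definition wchiCF_ge (I X : Type) (A : I -> X -> Prop) (n : nat) : Prop :=
  forall k, k < n -> ~ wCF_colorable A k.

(* wchi_CF(lambda, kappa, mu) >= n, with lambda = |L|, kappa = |K|, n finite:
   the supremum over all (lambda,kappa,mu)-systems is >= the finite number n
   iff some system has wchi_CF >= n. *)
Definition wchiCF_sys_ge (L K : Type) (mu n : nat) : Prop :=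
  exists (X : Type) (A : L -> X -> Prop), is_system K A mu /\ wchiCF_ge A n.

(* Main.v *)
(** Induction on [m]: from an [I]-indexed system on [Y] that resists [n] colours
one builds an [L]-indexed system that resists [n + l] colours, where [L] is
infinite and [L ^ I] has the size of [L]. The start is [I = 1], [n = 0], with the
single set [K]; then [L] runs through the beth numbers of [K].

The new points are the well-founded trees generated by leaves [L] and, for each
family [P] of [I] many [2l]-tuples of points, a fresh copy [Node P] of [Y]. The
new sets are [P i] together with the copy in [Node P] of the [i]-th old set, for
[P] without repetitions. Given a colouring with [n + l] colours, call a colour
frequent if it occurs on [L] many points. If at least [l] colours are frequent,
choose [P] so that [l] of them occur twice on every [P i] and no other colour
does; the remaining [n] colours on [Node P] are left to the old system. If fewer
than [l] are frequent, there are [L] many different [P] on which these colours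
occur twice and no other colour does; unless one of the copies [Node P] yields
the required set, each contains a point of a non-frequent colour, and by the
pigeonhole principle one of these colours is frequent after all. *)

Require Import Defs.
From mathcomp Require Import all_boot.
From mathcomp Require Import boolp classical_sets.
Set Implicit Arguments. Unset Strict Implicit. Unset Printing Implicit Defensive.

(** * Cardinal arithmetic *)

Lemma sval_inj (T : Type) (P : T -> Prop) : injective (@sval T P).
Proof.
by move=> [x ?] [y ?] /= exy; subst; congr exist; exact: Prop_irrelevance.
Qed.

Definition embeds (T U : Type) : Prop := exists f : T -> U, injective f.

Lemma embeds_trans (T U V : Type) : embeds T U -> embeds U V -> embeds T V.
Proof. by move=> [f fI] [g gI]; exists (g \o f); apply: inj_comp. Qed.

Lemma embeds_prod (T T' U U' : Type) :
  embeds T T' -> embeds U U' -> embeds (T * U) (T' * U').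
Proof.
move=> [f fI] [g gI]; exists (fun p => (f p.1, g p.2)).
by move=> [x y] [x' y'] /= [/fI -> /gI ->].
Qed.

Lemma embeds_sum (T T' U U' : Type) :
  embeds T T' -> embeds U U' -> embeds (T + U) (T' + U').
Proof.
move=> [f fI] [g gI].
exists (fun s => match s with inl x => inl (f x) | inr y => inr (g y) end).
by move=> [x|y] [x'|y'] //= [] => [/fI|/gI] ->.
Qed.

(** A maximal partial injection, given by its graph, is total or onto: otherwise the pair of an
    unmatched [x0] and an unmatched [y0] could be added. *)
Lemma embeds_total (T U : Type) : embeds T U \/ embeds U T.
Proof.
pose P (R : set (T * U)) :=
  (forall x y y', R (x, y) -> R (x, y') -> y = y') /\
  (forall x x' y, R (x, y) -> R (x', y) -> x = x').
have [F FP Ftot|R [[Rfun Rinj] Rmax]] := @Zorn_bigcup _ P.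
  have both s t : (\bigcup_(X in F) X)%classic s ->
      (\bigcup_(X in F) X)%classic t -> exists2 X, F X & X s /\ X t.
    move=> [X FX Xs] [Y FY Yt].
    by have [XY|YX] := Ftot _ _ FX FY; [exists Y|exists X] => //; split; auto.
  split=> [x y y'|x x' y] /both/[apply] -[X /FP [Xfun Xinj] [X1 X2]].
    exact: Xfun X1 X2.
  exact: Xinj X1 X2.
have [/choice[f fR]|/existsNP[x0 x0R]] := pselect (forall x, exists y, R (x, y)).
  left; exists f => x x' e; have Rx := fR x; rewrite e in Rx.
  exact: Rinj Rx (fR x').
have [/choice[g gR]|/existsNP[y0 y0R]] := pselect (forall y, exists x, R (x, y)).
  right; exists g => y y' e; have Ry := gR y; rewrite e in Ry.
  exact: Rfun Ry (gR y').
exfalso; apply: (Rmax (R `|` [set (x0, y0)])%classic).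
  split=> [t Rt|sub]; first by left.
  by apply: x0R; exists y0; apply: sub; right.
split=> [x y y' [Rxy|[-> ->]] [Rxy'|[]]|x x' y [Rxy|[-> ->]] [Rxy'|[]]] //.
- exact: Rfun Rxy Rxy'.
- by move=> ex _; case: x0R; exists y; rewrite -ex.
- by case: x0R; exists y'.
- exact: Rinj Rxy Rxy'.
- by move=> _ ey; case: y0R; exists x; rewrite -ey.
- by case: y0R; exists x'.
Qed.

(** The summands go to two disjoint slices of the square, at heights [a] and [b]. *)
Lemma embeds_sum_square (T U : Type) (a b : U) :
  a <> b -> embeds (U * U) U -> embeds T U -> embeds (T + U) U.
Proof.
move=> ab UU TU; apply: embeds_trans (embeds_sum TU (ex_intro _ id (fun _ _ => id))) _.
apply: embeds_trans UU.
exists (fun s => match s with inl x => (x, a) | inr x => (x, b) end).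
by move=> [x|x] [y|y] /= [] // -> // e; case: ab.
Qed.

(* A maximal injection [A * A -> A], among those extending one on a countable
   set, has a domain [A] as large as [K]: otherwise the complement of [A]
   contains a copy of [A], which has room for the pairs still missing over the
   union of both. *)
Lemma infinite_embeds_square (K : Type) : infinite_type K -> embeds (K * K) K.
Proof.
move=> [e eI].
(* The third coordinate is the value at the first two. The domain of a good [R] is a square, so its
   side can be read off the diagonal. *)
pose dom (R : set (K * K * K)) x := exists z, R (x, x, z).
pose good R := [/\ forall x y z z', R (x, y, z) -> R (x, y, z') -> z = z',
  forall x y x' y' z, R (x, y, z) -> R (x', y', z) -> x = x' /\ y = y',
  forall x y, dom R x -> dom R y -> exists z, R (x, y, z) &
  forall x y z, R (x, y, z) -> [/\ dom R x, dom R y & dom R z]].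
pose R0 : set (K * K * K) :=
  [set t | exists i j, t = (e i, e j, e (pickle (i, j)))]%classic.
have pI : injective (pickle : nat * nat -> nat) by exact: pcan_inj (@pickleK _).
have good0 : good R0.
  have dom0 i : dom R0 (e i) by exists (e (pickle (i, i))), i, i.
  split=> [x y z z'|x y x' y' z|x y|x y z].
  - by move=> [i [j [-> -> ->]]] [i' [j' [/eI -> /eI -> ->]]].
  - by move=> [i [j [-> -> ->]]] [i' [j' [-> -> /eI/pI[-> ->]]]].
  - move=> [z [i [j [-> _ _]]]] [z' [i' [j' [-> _ _]]]].
    by exists (e (pickle (i, i'))), i, i'.
  - by move=> [i [j [-> -> ->]]].
(* Zorn's lemma also asks for the union of the empty chain, so [R0] is demanded only inside nonempty
   relations. *)
pose P R := good R /\ forall t, R t -> (R0 `<=` R)%classic.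
have [F FP Ftot|R [[[Rfun Rinj Rtot Rdom] R0R] Rmax]] := @Zorn_bigcup _ P.
  set U := (\bigcup_(X in F) X)%classic.
  have both s t : U s -> U t -> exists X, [/\ F X, X s & X t].
    move=> [X FX Xs] [Y FY Yt].
    by have [XY|YX] := Ftot _ _ FX FY; [exists Y|exists X]; split; auto.
  have domU X x : F X -> dom X x -> dom U x by move=> FX [z Xz]; exists z, X.
  split; last by move=> t [X FX Xt] s R0s; exists X => //; exact: (FP X FX).2 Xt _ R0s.
  split=> [x y z z'|x y x' y' z|x y|x y z].
  - move=> /both/[apply] -[X [/FP [[Xfun _ _ _] _] Xz Xz']].
    exact: Xfun Xz Xz'.
  - move=> /both/[apply] -[X [/FP [[_ Xinj _ _] _] Xz Xz']].
    exact: Xinj Xz Xz'.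
  - move=> [z Uz] [z' Uz']; have [X [FX Xz Xz']] := both _ _ Uz Uz'.
    have [[_ _ Xtot _] _] := FP X FX.
    have [|| w Xw] := Xtot x y; [by exists z|by exists z'|].
    by exists w, X.
  - move=> [X FX Xz]; have [[_ _ _ Xdom] _] := FP X FX.
    by have [? ? ?] := Xdom _ _ _ Xz; split; apply: (domU X).
have {R0R} R0R : (R0 `<=` R)%classic.
  have [[t Rt]|noR] := pselect (exists t, R t); first exact: R0R Rt.
  exfalso; apply: (Rmax R0).
    split=> [t Rt|sub]; first by case: noR; exists t.
    by apply: noR; exists (e 0, e 0, e (pickle (0, 0))); apply: sub; exists 0, 0.
  by split=> // t _.
pose A := {x | dom R x}; pose C := {x | ~ dom R x}.
have AI : injective (@sval _ (dom R)) by exact: sval_inj.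
have CI : injective (@sval _ (fun x => ~ dom R x)) by exact: sval_inj.
have A0 i : dom R (e i).
  by exists (e (pickle (i, i))); apply: R0R; exists i, i.
pose a0 : A := exist _ _ (A0 0); pose a1 : A := exist _ _ (A0 1).
have a01 : a0 <> a1 by move=> /(congr1 (@proj1_sig _ _))/eI.
have AA : embeds (A * A) A.
  have /choice[p pR] : forall t : A * A, exists z : A, R (sval t.1, sval t.2, sval z).
    move=> [[x Ax] [y Ay]] /=; have [z Rz] := Rtot _ _ Ax Ay.
    by have [_ _ Az] := Rdom _ _ _ Rz; exists (exist _ z Az).
  exists p => -[x y] [x' y'] epp; have R1 := pR (x, y); have R2 := pR (x', y').
  rewrite epp /= in R1 R2.
  by have [/AI -> /AI ->] := Rinj _ _ _ _ _ R1 R2.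
have AsA : embeds (A + A) A by apply: (embeds_sum_square a01 AA); exists id.
have [[g gI]|CA] := embeds_total A C.
  have [c cI] : embeds ((A + A) * (A + A)) A.
    exact: embeds_trans (embeds_prod AsA AsA) AA.
  pose h (s : A + A) : K := match s with inl x => sval x | inr x => sval (g x) end.
  have hI : injective h.
    move=> [x|x] [y|y] //=; [by move=> /AI ->| | |by move=> /CI/gI ->] => E.
      by case: (svalP (g y)); rewrite -E; exact: svalP.
    by case: (svalP (g x)); rewrite E; exact: svalP.
  have hA s : dom R (h s) -> exists x, s = inl x.
    by case: s => [x|x] /=; [exists x|move=> /(svalP (g x))].
  (* Pairs outside the old square take values in the range of [g], hence off the old values; [c]
     keeps them apart. *)
  pose new t := exists a b : A + A, ~ (dom R (h a) /\ dom R (h b)) /\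
    t = (h a, h b, sval (g (c (a, b)))).
  pose R' := (R `|` new)%classic.
  have R'h a b : exists z, R' (h a, h b, h z).
    have [[Da Db]|nD] := pselect (dom R (h a) /\ dom R (h b)).
      have [z Rz] := Rtot _ _ Da Db; have [_ _ Dz] := Rdom _ _ _ Rz.
      by exists (inl (exist _ z Dz)); left.
    by exists (inr (c (a, b))); right; exists a, b.
  have R'P x y z : R' (x, y, z) -> exists a b d, [/\ x = h a, y = h b & z = h d].
    move=> [/Rdom[Dx Dy Dz]|[a [b [_ [-> -> ->]]]]].
      by exists (inl (exist _ x Dx)), (inl (exist _ y Dy)), (inl (exist _ z Dz)).
    by exists a, b, (inr (c (a, b))).
  have domh a : dom R' (h a) by have [z Rz] := R'h a a; exists (h z).
  exfalso; apply: (Rmax R').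
    split=> [t Rt|sub]; first by left.
    have [z R'z] := R'h (inr a0) (inr a0).
    by have [/hA[]] := Rdom _ _ _ (sub _ R'z).
  split; last by move=> t _ s /R0R; left.
  split=> [x y z z'|x y x' y' z|x y|x y z].
  - move=> [Rz|[a [b [nD [-> -> ->]]]]] [Rz'|[a' [b' [nD']]]].
    + exact: Rfun Rz Rz'.
    + move=> [? ? _]; subst; have [Da Db _] := Rdom _ _ _ Rz.
      by case: nD'.
    + by have [Da Db _] := Rdom _ _ _ Rz'; case: nD.
    + by move=> [/hI -> /hI -> ->].
  - move=> [Rz|[a [b [nD [-> -> ->]]]]] [Rz'|[a' [b' [nD']]]].
    + exact: Rinj Rz Rz'.
    + move=> [? ? ?]; subst; have [_ _ D] := Rdom _ _ _ Rz.
      by case: (svalP (g _) D).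
    + by have [_ _ D] := Rdom _ _ _ Rz'; case: (svalP (g _) D).
    + by move=> [-> -> /CI/gI/cI[-> ->]].
  - move=> [z /R'P[a [_ [_ [-> _ _]]]]] [z' /R'P[b [_ [_ [-> _ _]]]]].
    by have [d R'd] := R'h a b; exists (h d).
  - by move=> /R'P[a [b [d [-> -> ->]]]].
have KA : embeds K A.
  apply: embeds_trans (embeds_sum_square a01 AA CA).
  exists (fun x => match pselect (dom R x) with
                   | left Dx => inr (exist _ x Dx)
                   | right nDx => inl (exist _ x nDx) end).
  by move=> x y; case: pselect => Dx; case: pselect => Dy // [].
apply: embeds_trans (embeds_prod KA KA) _.
by apply: embeds_trans AA _; exists sval.
Qed.

Lemma embeds_fun (I T U : Type) : embeds T U -> embeds (I -> T) (I -> U).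
Proof.
move=> [f fI]; exists (fun g i => f (g i)) => g g' E; apply/funext => i.
by apply: fI; rewrite (congr1 (fun k => k i) E).
Qed.

(** Two predicates on [T] are one predicate on [T + T], and [T + T] embeds in [T]. *)
Lemma embeds_pred_square (T : Type) (a b : T) :
  a <> b -> embeds (T * T) T -> embeds ((T -> Prop) * (T -> Prop)) (T -> Prop).
Proof.
move=> ab TT.
have [c cI] := embeds_sum_square ab TT (ex_intro _ id (fun _ _ => id)).
exists (fun p t => (exists2 x, t = c (inl x) & p.1 x) \/
                   (exists2 x, t = c (inr x) & p.2 x)).
move=> [p1 p2] [q1 q2] /= E; congr pair; apply/funext => x.
  have /= := congr1 (fun k => k (c (inl x))) E => Ex.
  have cl (r1 r2 : T -> Prop) : ((exists2 y, c (inl x) = c (inl y) & r1 y) \/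
      (exists2 y, c (inl x) = c (inr y) & r2 y)) = r1 x.
    by apply/propext; split=> [[[y /cI[->]]|[y /cI]]|rx] //; left; exists x.
  by rewrite !cl in Ex.
have /= := congr1 (fun k => k (c (inr x))) E => Ex.
have cr (r1 r2 : T -> Prop) : ((exists2 y, c (inr x) = c (inl y) & r1 y) \/
    (exists2 y, c (inr x) = c (inr y) & r2 y)) = r2 x.
  by apply/propext; split=> [[[y /cI]|[y /cI[->]]]|rx] //; right; exists x.
by rewrite !cr in Ex.
Qed.

(** Uncurrying gives predicates on [T * T]. This bounds [L ^ I] by [L] when [L] is the next beth
    number after [I]. *)
Lemma embeds_fun_pred (T : Type) :
  embeds (T * T) T -> embeds (T -> (T -> Prop)) (T -> Prop).
Proof.
move=> [p pI]; exists (fun F t => exists2 xy, t = p xy & F xy.1 xy.2).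
move=> F G E; apply/funext => x; apply/funext => y.
have pE H : (exists2 xy, p (x, y) = p xy & H xy.1 xy.2) = H x y :> Prop.
  by apply/propext; split=> [[xy /pI <-]|Hxy] //; exists (x, y).
by rewrite -(pE F) -(pE G) (congr1 (fun k => k (p (x, y))) E).
Qed.

(** Iterated pairing along the list of values; it can be undone because all the lists have length
    [N]. *)
Lemma embeds_ord_fun (N : nat) (L : Type) (a : L) :
  embeds (L * L) L -> embeds ('I_N -> L) L.
Proof.
move=> [p pI]; pose fold := foldr (fun x y => p (x, y)) a.
have foldI (s t : seq L) : size s = size t -> fold s = fold t -> s = t.
  elim: s t => [|x s IHs] [|y t] //= [/IHs {}IHs] /pI[-> /IHs ->] //.
exists (fun F => fold (map F (enum 'I_N))) => F G.
move=> /foldI; rewrite !size_map => /(_ erefl)/eq_in_map E.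
by apply/funext => j; apply: E; rewrite mem_enum.
Qed.

(* Splitting [L] as [L * L], either some row avoids the first colour, or that
   colour occurs in each row. *)
Lemma pigeonhole (L X : Type) (D : eqType) (f : X -> D) (s : seq D) (g : L -> X) :
  inhabited L -> embeds (L * L) L -> injective g -> (forall a, f (g a) \in s) ->
  exists2 d, d \in s & exists g' : L -> X, injective g' /\ forall a, f (g' a) = d.
Proof.
move=> [a0] [p pI]; elim: s g => [|c s IHs] g gI gs; first by have := gs a0.
have [[a aP]|rows] := pselect (exists a, forall b, f (g (p (a, b))) != c).
  have [||d ds dP] := IHs (fun b => g (p (a, b))).
  - by move=> b b' /gI/pI[].
  - by move=> b; have := gs (p (a, b)); rewrite inE (negPf (aP b)).
  - by exists d => //; rewrite inE ds orbT.
have /choice[b bP] a : exists b, f (g (p (a, b))) = c.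
  apply: contrapT => noc; apply: rows; exists a => b.
  by apply/eqP => E; apply: noc; exists b.
exists c; first by rewrite inE eqxx.
by exists (fun a => g (p (a, b a))); split=> // x y /gI/pI[].
Qed.

(** * Points and copies *)

Inductive tree (L I J Y : Type) : Type :=
  | Leaf (a : L)
  | Node (P : I -> J -> tree L I J Y) (y : Y).
Arguments Leaf {L I J Y} a.

(** With subtrees replaced by their codes, a tree becomes an element of [L + (I -> J -> L) * Y];
    injectivity of the coding follows by induction. *)
Lemma embeds_tree (L I J Y : Type) :
  embeds (L + (I -> J -> L) * Y) L -> embeds (tree L I J Y) L.
Proof.
move=> [e eI].
exists (fix code t := match t with
  | Leaf a => e (inl a)
  | Node P y => e (inr (fun i j => code (P i j), y)) end).
elim=> [a|P IHP y] [b|Q z] /eI // [] => [-> //|E ->].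
congr Node; apply/funext => i; apply/funext => j.
exact: IHP (congr1 (fun k => k i j) E).
Qed.

(** The two nodes would be children of one another, which well-foundedness excludes. *)
Lemma tree_acyclic (L I J Y : Type) (P Q : I -> J -> tree L I J Y) i j i' j' y z :
  P i j = Node Q y -> Q i' j' = Node P z -> False.
Proof.
have: forall t : tree L I J Y, forall P Q i j i' j' y z,
  t = Node P z -> P i j = Node Q y -> Q i' j' = Node P z -> False.
  elim=> [//|R IH x] {}P {}Q {}i {}j {}i' {}j' {}y {}z E PQ QP.
  by case: E => RP _; subst R; exact: (IH _ _ _ _ _ _ _ _ _ _ PQ QP PQ).
by move=> H PQ QP; apply: H (erefl (Node P z)) PQ QP.
Qed.

(** An enumeration without repetitions is carried along injections more easily than a bijection with
    a subtype. *)
Definition copy_of (K X : Type) (S : X -> Prop) : Prop :=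
  exists phi : K -> X, injective phi /\ forall x, S x <-> exists k, phi k = x.

Lemma copy_of_ext (K X : Type) (S S' : X -> Prop) :
  (forall x, S x <-> S' x) -> copy_of K S -> copy_of K S'.
Proof. by move=> SS' [phi [phiI phiP]]; exists phi; split=> // x; rewrite -SS'. Qed.

Lemma copy_of_image (K X Y : Type) (g : X -> Y) (S : X -> Prop) :
  injective g -> copy_of K S -> copy_of K (fun y => exists2 x, y = g x & S x).
Proof.
move=> gI [phi [phiI phiP]]; exists (g \o phi); split; first exact: inj_comp.
move=> y; split=> [[x -> /phiP[k <-]]|[k <-]]; first by exists k.
by exists (phi k) => //; apply/phiP; exists k.
Qed.

(** Hilbert's hotel: [x0] moves in at [e 0], and the points along [e] move on by one place. *)
Lemma copy_of_add1 (K X : Type) (S : X -> Prop) (x0 : X) :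
  infinite_type K -> copy_of K S -> copy_of K (fun x => x = x0 \/ S x).
Proof.
move=> [e eI] [phi [phiI phiP]].
have [Sx0|nSx0] := pselect (S x0).
  by apply: copy_of_ext (ex_intro _ phi (conj phiI phiP)) => x; split=> [|[->|]]; auto.
have phi0 k : phi k <> x0 by move=> E; apply: nSx0; apply/phiP; exists k.
have /choice[psi psiP] k : exists x, [/\ k = e 0 -> x = x0,
    forall t, k = e t.+1 -> x = phi (e t) & (forall t, k <> e t) -> x = phi k].
  have [[[|t] ->]|ne] := pselect (exists t, k = e t).
  - by exists x0; split=> [|t /eI|/(_ 0)].
  - by exists (phi (e t)); split=> [/eI|u /eI[->]|/(_ t.+1)].
  - by exists (phi k); split=> // [E|t E]; case: ne; [exists 0|exists t.+1].
have psi0 : psi (e 0) = x0 by have [->] := psiP (e 0).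
have psiS t : psi (e t.+1) = phi (e t) by have [_ H _] := psiP (e t.+1); exact: H.
have psiN k : (forall t, k <> e t) -> psi k = phi k by have [] := psiP k.
have cases k : (exists t, k = e t) \/ (forall t, k <> e t).
  have [|ne] := pselect (exists t, k = e t); first by left.
  by right=> t E; apply: ne; exists t.
exists psi; split.
  move=> k k'; have [[[|t] ->]|ne] := cases k; have [[[|t'] ->]|ne'] := cases k'.
  all: rewrite ?psi0 ?psiS ?psiN //.
  - by move=> /esym/phi0.
  - by move=> /esym/phi0.
  - by move=> /phi0.
  - by move=> /phiI/eI ->.
  - by move=> /phiI/esym/ne'.
  - by move=> /phi0.
  - by move=> /phiI/ne.
  - exact: phiI.
move=> x; split=> [[->|/phiP[k <-]]|[k <-]]; first by exists (e 0).
  have [[t ->]|ne] := cases k; first by exists (e t.+1).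
  by exists k; exact: psiN.
have [[[|t] ->]|ne] := cases k; [by left| |]; right; apply/phiP.
  by exists (e t).
by exists k; rewrite psiN.
Qed.

Lemma copy_of_add (K X : Type) (N : nat) (p : 'I_N -> X) (S : X -> Prop) :
  infinite_type K -> copy_of K S -> copy_of K (fun x => (exists j, x = p j) \/ S x).
Proof.
move=> Kinf copyS.
have H (s : seq 'I_N) : copy_of K (fun x => (exists2 j, j \in s & x = p j) \/ S x).
  elim: s => [|j s IHs].
    by apply: copy_of_ext copyS => x; split=> [|[[]|]] //; right.
  apply: copy_of_ext (copy_of_add1 (p j) Kinf IHs) => x; split.
    move=> [->|[[i js ->]|]]; last by right.
      by left; exists j; rewrite ?inE ?eqxx.
    by left; exists i; rewrite ?inE ?js ?orbT.
  move=> [[i]|]; last by right; right.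
  by rewrite inE => /orP[/eqP -> ->|js ->]; [left|right; left; exists i].
apply: copy_of_ext (H (enum 'I_N)) => x; split=> [[[j _]|]|[[j]|]]; try by right.
  by left; exists j.
by left; exists j; rewrite ?mem_enum.
Qed.

Lemma card_lt_ord (X : Type) (N : nat) (p : 'I_N -> X) (S : X -> Prop) :
  (forall x, S x -> exists j, x = p j) -> card_lt S N.+1.
Proof.
move=> Sp; exists (map p (enum 'I_N)); rewrite size_map size_enum_ord; split=> //.
by move=> x /Sp[j ->]; exists j => //; rewrite (nth_map j) ?size_enum_ord ?nth_ord_enum.
Qed.

Lemma card_lt_image (X Y : Type) (g : X -> Y) (S : X -> Prop) (S' : Y -> Prop) mu :
  card_lt S mu -> (forall y, S' y -> exists2 x, y = g x & S x) -> card_lt S' mu.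
Proof.
move=> [s [smu Ss]] S'S; exists (map g s); rewrite size_map; split=> // _ /S'S[x -> Sx].
by have [i si ->] := Ss _ Sx; exists i; rewrite ?(nth_map x).
Qed.

(** * Systems resisting weak conflict free colourings *)

(** Distinctness of the members is recovered at the end: two equal ones would meet in an infinite
    set. *)
Definition system (I K X : Type) (mu : nat) (A : I -> X -> Prop) : Prop :=
  (forall i, copy_of K (A i)) /\
  forall i j, i <> j -> card_lt (fun x => A i x /\ A j x) mu.

Definition unique_color (X : Type) (S : X -> Prop) (f : X -> nat) (z : nat) : Prop :=
  exists x, S x /\ f x = z /\ forall y, S y -> f y = z -> y = x.

(* Points whose colour is not in [s] count as uncoloured. *)
Definition hard (I X : Type) (n : nat) (A : I -> X -> Prop) : Prop :=
  forall (f : X -> nat) (s : seq nat), size s <= n ->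
  exists i, forall z, z \in s -> ~ unique_color (A i) f z.

(** Within a tuple this puts a doubled colour on two different points; between tuples it makes those
    of one [P] disjoint. *)
Definition jointly_injective (I J X : Type) (P : I -> J -> X) : Prop :=
  forall i j i' j', P i j = P i' j' -> i = i' /\ j = j'.

Section Blocks.

Variables (I K L Y : Type) (N n l : nat) (A : I -> Y -> Prop).
Local Notation pt := (tree L I 'I_N Y).

Definition block (P : I -> 'I_N -> pt) (i : I) (t : pt) : Prop :=
  (exists j, t = P i j) \/ (exists2 y, t = Node P y & A i y).

Lemma block_copy P i :
  infinite_type K -> copy_of K (A i) -> copy_of K (block P i).
Proof.
move=> Kinf copyA; apply: copy_of_add => //.
by apply: copy_of_image copyA => y z [].
Qed.

(* By [tree_acyclic], at most one of [P], [P'] has values in the copy of [Y] below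
   the other, so the intersection is contained in one of the tuples. *)
Lemma block_meet P P' i i' :
  (forall i j, i <> j -> card_lt (fun x => A i x /\ A j x) N.+1) ->
  jointly_injective P -> (P, i) <> (P', i') ->
  card_lt (fun t => block P i t /\ block P' i' t) N.+1.
Proof.
move=> thinA PI neq.
have [PP'|PP'] := pselect (P = P').
  subst P'; have ii' : i <> i' by move=> E; apply: neq; rewrite E.
  apply: (card_lt_image (g := Node P) (thinA _ _ ii')) => t.
  move=> [[[j ->]|[y -> Aiy]] [[j' E]|[y' E Ai'y']]].
  - by have [] := PI _ _ _ _ E.
  - by case: (tree_acyclic E E).
  - by case: (tree_acyclic (esym E) (esym E)).
  - by case: E => E; subst y'; exists y.
have [[i0 [j0 [y0 hit]]]|nohit] := pselect (exists i j y, P i j = Node P' y).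
  apply: (card_lt_ord (p := P i)) => t [[//|[y -> _]]] [[j E]|[y' [/PP' //]]].
  by case: (tree_acyclic hit (esym E)).
apply: (card_lt_ord (p := P' i')) => t [[[j ->]|[y -> _]]] [//|[y' E _]].
  by case: nohit; exists i, j, y'.
by case: E => /PP'.
Qed.

Hypotheses (l_gt0 : 0 < l) (NE : N = 2 * l) (I_inh : inhabited I) (L_inh : inhabited L).
Hypotheses (LL : embeds (L * L) L) (ILN : embeds (I * 'I_N) L).

Section Coloring.

Variables (f : pt -> nat) (s : seq nat).

Let h (t : pt) : option nat := if f t \in s then Some (f t) else None.

Let hP t z : z \in s -> h t = Some z <-> f t = z.
Proof.
rewrite /h => zs; case: ifP => [_|fs]; first by split=> [[]|->].
by split=> // E; rewrite E zs in fs.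
Qed.

Let hs t z : h t = Some z -> z \in s.
Proof. by rewrite /h; case: ifP => // fs [<-]. Qed.

(** The value [None], meaning no colour from [s], may be frequent too. *)
Let frequent (d : option nat) : Prop :=
  exists g : L -> pt, injective g /\ forall a, h (g a) = d.

(* [d] only fills up the tuples when [t] has fewer than [l] colours. *)
Lemma frequent_pairs (t : seq nat) (d : option nat) :
  size t <= l -> (forall z, z \in t -> frequent (Some z)) -> frequent d ->
  (forall z, d = Some z -> z \in t) ->
  exists P : L -> I -> 'I_N -> pt,
    [/\ forall a, jointly_injective (P a), injective P,
        forall a i z, z \in t ->
          exists j j', [/\ j <> j', h (P a i j) = Some z & h (P a i j') = Some z] &
        forall a i j z, h (P a i j) = Some z -> z \in t].
Proof.
move=> tl tfreq dfreq dt.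
have /choice[G GP] c : exists g : L -> pt, frequent c ->
    injective g /\ forall a, h (g a) = c.
  have [[g gP]|nf] := pselect (frequent c); first by exists g.
  by exists (fun a => Leaf a).
(* A frequent value is taken at points indexed by [L]; [q] reserves a separate index for every
   [(a, (i, j))]. *)
have [q qI] : embeds (L * (I * 'I_N)) L.
  exact: embeds_trans (embeds_prod (ex_intro _ id (fun _ _ => id)) ILN) LL.
(* Each colour of [t] is listed twice, which takes at most [2 * l = N] places; the default [d] fills
   the rest. *)
pose c (j : 'I_N) := nth d (map Some (t ++ t)) j.
have cP j : c j = d \/ exists2 z, z \in t & c j = Some z.
  have [jt|tj] := ltnP j (size (map Some (t ++ t))); last first.
    by left; rewrite /c nth_default.
  right; have /mapP[z] := mem_nth d jt.
  by rewrite mem_cat orbb => zt E; exists z.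
have cfreq j : frequent (c j).
  by case: (cP j) => [->|[z zt ->]] //; exact: tfreq.
pose P a i j := G (c j) (q (a, (i, j))).
have hPc a i j : h (P a i j) = c j by have [_] := GP _ (cfreq j); exact.
exists P; split.
- move=> a i j i' j' E; have Ec : c j = c j' by rewrite -(hPc a i) E hPc.
  rewrite /P -Ec in E; have [GI _] := GP _ (cfreq j).
  by have /qI[] := GI _ _ E.
- case: (I_inh) => i; have N0 : 0 < N by rewrite NE muln_gt0.
  move=> a a' /(congr1 (fun k => k i (Ordinal N0))) E.
  by have [GI _] := GP _ (cfreq (Ordinal N0)); have /qI[] := GI _ _ E.
- move=> a i z zt; have zi : index z t < size t by rewrite index_mem.
  have j1 : index z t < N by rewrite NE mul2n -addnn ltn_addl // (leq_trans zi).
  have j2 : size t + index z t < N.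
    by rewrite NE mul2n -addnn -addnS leq_add // (leq_trans zi).
  exists (Ordinal j1), (Ordinal j2); split.
  + by move=> [E]; move: zi; rewrite E ltnNge leq_addr.
  + by rewrite hPc /c (nth_map 0) ?size_cat ?ltn_addr // nth_cat zi nth_index.
  + rewrite hPc /c (nth_map 0) ?size_cat ?ltn_add2l // nth_cat.
    by rewrite ltnNge leq_addr /= addKn nth_index.
- move=> a i j z; rewrite hPc => cz; case: (cP j) => [cd|[z' z't cz']].
    by apply: dt; rewrite -cd.
  by move: cz; rewrite cz' => -[<-].
Qed.

Lemma block_hard : size s <= n + l -> hard n A ->
  exists P i, jointly_injective P /\ forall z, z \in s -> ~ unique_color (block P i) f z.
Proof.
move=> sn hardA; apply: contrapT => noP.
have uniq_block P i : jointly_injective P -> exists2 z, z \in s & unique_color (block P i) f z.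
  move=> PI; apply: contrapT => nz; apply: noP; exists P, i; split=> // z zs uz.
  by apply: nz; exists z.
pose F := [seq z <- undup s | `[< frequent (Some z) >]].
have FP z : (z \in F) = (z \in s) && `[< frequent (Some z) >].
  by rewrite mem_filter mem_undup andbC.
have Ffreq z : z \in F -> frequent (Some z) by rewrite FP => /andP[_ /asboolP].
(* A colour of [t] occurs twice on the tuple, so it is not unique on the block, and the tuple shows
   no other colour of [s]. Hence the unique colour sits in the copy of [Y]. *)
have fresh (t : seq nat) (P : I -> 'I_N -> pt) i : jointly_injective P ->
    (forall z, z \in t ->
      exists j j', [/\ j <> j', h (P i j) = Some z & h (P i j') = Some z]) ->
    (forall j z, h (P i j) = Some z -> z \in t) ->
    exists z, [/\ z \in s, z \notin t & unique_color (A i) (fun y => f (Node P y)) z].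
  move=> PI twice Pt; have [z zs [x [Bx [fx xu]]]] := uniq_block P i PI.
  have zt : z \notin t.
    apply/negP => /twice[j [j' [jj' /hP -/(_ zs) fj /hP -/(_ zs) fj']]].
    have Ej : P i j = x by apply: xu => //; left; exists j.
    have Ej' : P i j' = x by apply: xu => //; left; exists j'.
    by apply: jj'; apply: (PI i j i j' _).2; rewrite Ej Ej'.
  exists z; split=> //; case: Bx => [[j E]|[y E Ay]]; subst x.
    by case/negP: zt; apply: (Pt j); apply/hP.
  exists y; split=> //; split=> // y' Ay' fy'.
  suff: Node P y' = Node P y by case.
  by apply: xu => //; right; exists y'.
(* Among the leaves some value, a colour or [None], is frequent; as filler it brings no colour
   outside [F] into the tuples. *)
have [d dfreq ds] : exists2 d, frequent d & forall z, d = Some z -> z \in F.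
  have LeafI : injective (fun a => Leaf a : pt) by move=> a b [].
  have [a|d _ dfreq] := pigeonhole L_inh LL LeafI (f := h) (s := None :: map Some s).
    rewrite inE /h; case: ifP => // fs.
    by apply/orP; right; apply/mapP; exists (f (Leaf a)).
  exists d => // z E; rewrite FP; apply/andP; split; last by apply/asboolP; rewrite -E.
  by case: dfreq => g [_ gd]; case: (L_inh) => a; apply: (@hs (g a)); rewrite gd.
have [lF|Fl] := leqP l (size F).
  pose t := take l F.
  have tF z : z \in t -> z \in F by exact: mem_take.
  have st : size t = l by rewrite size_take_min; apply/minn_idPl.
  (* This colour is passed on as filler; [t] is nonempty because [0 < l]. *)
  have z0t : nth 0 t 0 \in t by rewrite mem_nth // st.
  have tfreq z : z \in t -> frequent (Some z) by move=> /tF/Ffreq.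
  have [|P [PI _ Ptwice Pt]] := frequent_pairs (eq_leq st) tfreq (tfreq _ z0t) _.
    by move=> z [<-].
  case: (L_inh) => a.
  pose r := [seq z <- undup s | z \notin t].
  (* Removing the [l] distinct colours of [t] leaves at most [n]; [undup] keeps the count right if
     [s] has repetitions. *)
  have rn : size r <= n.
    have tus : size t <= count (mem t) (undup s).
      rewrite -size_filter; apply: uniq_leq_size.
        by rewrite take_uniq // filter_uniq // undup_uniq.
      by move=> z zt; rewrite mem_filter /= zt mem_undup; move: (tF _ zt); rewrite FP => /andP[].
    have := count_predC (mem t) (undup s).
    rewrite size_filter => E; rewrite -(leq_add2l l) -{1}st addnC.
    rewrite (leq_trans _ (leq_trans (size_undup s) _)) //; last by rewrite addnC.
    by rewrite -E addnC leq_add2r.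
  have [i iP] := hardA (fun y => f (Node (P a) y)) r rn.
  have [z [zs zt /iP[]]] := fresh t (P a) i (PI a) (Ptwice a i) (Pt a i).
  by rewrite mem_filter zt mem_undup.
have [P [PI PL Ptwice Pt]] := frequent_pairs (ltnW Fl) Ffreq dfreq ds.
case: (I_inh) => i.
have /choice[x xP] a : exists x, (exists y, x = Node (P a) y) /\
    h x \in map Some [seq z <- s | z \notin F].
  have [z [zs zF [y [_ [fy _]]]]] := fresh F (P a) i (PI a) (Ptwice a i) (Pt a i).
  exists (Node (P a) y); split; first by exists y.
  by apply/mapP; exists z; [rewrite mem_filter zF|apply/hP].
(* A node determines its family [P a], and [P] is injective in [a]. *)
have xI : injective x.
  move=> a a' E; have [[y Ey] _] := xP a; have [[y' Ey'] _] := xP a'.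
  by apply: PL; move: Ey; rewrite E Ey' => -[].
have [a|_ /mapP[z + ->] zfreq] := pigeonhole L_inh LL xI (s := map Some [seq z <- s | z \notin F]) (f := h).
  by have [] := xP a.
by rewrite mem_filter FP => /andP[+ zs]; rewrite zs /= => /asboolP; apply.
Qed.

End Coloring.

End Blocks.

(** * Iteration along the beth numbers *)

Lemma system_step (I K L Y : Type) (l n : nat) (A : I -> Y -> Prop) :
  infinite_type K -> 0 < l -> inhabited I ->
  embeds (L * L) L -> embeds K L -> embeds I L -> embeds Y L -> embeds (I -> L) L ->
  system K (2 * l).+1 A -> hard n A ->
  exists (X : Type) (B : L -> X -> Prop),
    [/\ embeds X L, system K (2 * l).+1 B & hard (n + l) B].
Proof.
move=> Kinf l0 Iinh LL KL IL YL ILL [copyA thinA] hardA.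
have idL : embeds L L by exists id.
have [a0 [a1 a01]] : exists a b : L, a <> b.
  case: Kinf KL => e eI [g gI]; exists (g (e 0)), (g (e 1)).
  by move=> /gI/eI.
have sumL T : embeds T L -> embeds (T + L) L by exact: embeds_sum_square a01 LL.
pose J := 'I_(2 * l); pose pt := tree L I J Y.
have JL : embeds J L.
  by apply: embeds_trans KL; case: Kinf => e eI; exists (fun j => e j) => j j' /eI/val_inj.
have ILN : embeds (I * J) L by apply: embeds_trans (embeds_prod IL JL) LL.
have IJL : embeds (I -> J -> L) L.
  by apply: embeds_trans (embeds_fun I (embeds_ord_fun _ a0 LL)) ILL.
have ptL : embeds pt L.
  apply: embeds_tree; apply: (embeds_trans _ LL).
  have [c cI] : embeds (L + L) L by exact: sumL.
  have sq : embeds ((I -> J -> L) * Y) L by apply: embeds_trans (embeds_prod IJL YL) LL.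
  apply: embeds_trans (embeds_sum idL sq) _.
  by exists (fun x => (c x, a0)) => x y [/cI].
(* The pairs [(P, i)] get labels in [L], since the new system has to be indexed by [L] itself. *)
have [e eI] : embeds ((I -> J -> pt) * I) L.
  apply: embeds_trans (embeds_prod _ IL) LL.
  apply: embeds_trans IJL; apply: embeds_fun; exact: embeds_fun.
pose code z P i := jointly_injective P /\ z = e (P, i).
(* Labels that code no block get pairwise disjoint dummy sets. *)
pose B (z : L) (x : pt + L * K) := match x with
  | inl t => exists P i, code z P i /\ block A P i t
  | inr w => w.1 = z /\ ~ exists P i, code z P i end.
have Bcode z P i t : code z P i -> B z (inl t) <-> block A P i t.
  move=> zP; split=> [[P' [i' [zP' Bt]]]|]; last by exists P, i.
  by move: zP zP' => [_ ->] [_ /eI[-> ->]].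
have Bpad z P i w : code z P i -> ~ B z (inr w).
  by move=> zP [_]; apply; exists P, i.
exists (pt + L * K)%type, B; split.
- apply: embeds_trans (embeds_sum ptL _) (sumL _ idL).
  exact: embeds_trans (embeds_prod idL KL) LL.
- split=> [z|z z' zz'].
    have [[P [i zP]]|nz] := pselect (exists P i, code z P i).
      have inlI : injective (@inl pt (L * K)) by move=> t t' [].
      apply: copy_of_ext (copy_of_image inlI (block_copy P Kinf (copyA i))).
      move=> [t|w]; split=> [[u //]|].
      - by move=> [<-] /(Bcode _ _ _ _ zP).
      - by move=> /(Bcode _ _ _ _ zP); exists t.
      - by move=> /(Bpad _ _ _ _ zP).
    exists (fun k => inr (z, k)); split=> [k k' []|[t|[w k]]] //=.
      split=> [[P [i [zP _]]]|[]] //.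
      by case: nz; exists P, i.
    by split=> [[-> _]|[k' [<- _]]]; first by exists k.
  have [[P [i zP]]|nz] := pselect (exists P i, code z P i); last first.
    exists [::]; split=> // -[t|w] /= [].
      by move=> [P [i [zP _]]]; case: nz; exists P, i.
    by move=> [wz _] [wz' _]; case: zz'; rewrite -wz.
  have [[P' [i' zP']]|nz'] := pselect (exists P i, code z' P i); last first.
    exists [::]; split=> // -[t|w] [].
      by move=> _ [P' [i' [zP' _]]]; case: nz'; exists P', i'.
    by move=> /(Bpad _ _ _ _ zP).
  have neq : (P, i) <> (P', i').
    by move=> E; apply: zz'; rewrite zP.2 zP'.2 E.
  apply: (card_lt_image (g := inl) (block_meet thinA zP.1 neq)) => -[t|w] [];
    last by move=> /(Bpad _ _ _ _ zP).
  by move=> /(Bcode _ _ _ _ zP) ? /(Bcode _ _ _ _ zP') ?; exists t.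
- move=> f s sn.
  have [P [i [PI Pi]]] :=
    block_hard l0 erefl Iinh (inhabits a0) LL ILN (fun t => f (inl t)) sn hardA.
  exists (e (P, i)) => z /Pi nu [x [Bx [fx xu]]].
  have zP : code (e (P, i)) P i by [].
  case: x Bx fx xu => [t|w] Bx fx xu; last by case: (Bpad _ _ _ _ zP Bx).
  apply: nu; exists t; split; first exact/Bcode.
  split=> // t' /(Bcode _ _ _ _ zP) Bt' ft'.
  by have [] := xu _ Bt' ft'.
Qed.

(** The case [m = 0] already takes one step, from a single set with [L = K]; hence [m.+1] gains of
    [l]. The two embeddings are carried along because the next step draws on them. *)
Lemma beth_system (K : Type) (m l : nat) :
  infinite_type K -> 0 < l ->
  [/\ embeds (beth K m * beth K m) (beth K m), embeds K (beth K m) &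
  exists (X : Type) (A : beth K m -> X -> Prop),
    [/\ embeds X (beth K m), system K (2 * l).+1 A & hard (m.+1 * l) A]].
Proof.
move=> Kinf l0; elim: m => [|m [IHsq IHK [X [A [XL sysA hardA]]]]].
  have KK := infinite_embeds_square Kinf; have idK : embeds K K by exists id.
  split=> //; rewrite (_ : 1 * l = 0 + l) ?mul1n //.
  have [e _] := Kinf.
  apply: (@system_step unit K K K l 0 (fun _ _ => True)) => //.
  - by exists (fun _ => e 0) => -[] [].
  - by exists (fun g => g tt) => g g' E; apply/funext => -[].
  - split=> [_|[] [] //]; exists id; split=> // x; split=> // _.
    by exists x.
  - by move=> f [|//] _; exists tt.
have [e eI] := Kinf; have [g gI] := IHK.
have ab : g (e 0) <> g (e 1) by move=> /gI/eI.
have sq : embeds (beth K m.+1 * beth K m.+1) (beth K m.+1).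
  exact: embeds_pred_square ab IHsq.
have up : embeds (beth K m) (beth K m.+1).
  by exists (fun x => eq x) => x y E; rewrite (congr1 (fun k => k y) E).
have KL := embeds_trans IHK up.
split=> //; rewrite [m.+2 * l]mulSnr.
apply: (@system_step (beth K m) K (beth K m.+1) X l (m.+1 * l) A) => //.
- exact: inhabits (g (e 0)).
- exact: embeds_trans XL up.
- exact: embeds_fun_pred.
Qed.

(** * Return to cardinalities and partial colourings *)

Lemma copy_of_equipotent (K X : Type) (S : X -> Prop) :
  copy_of K S -> equipotent {x : X | S x} K.
Proof.
move=> [phi [phiI phiP]].
have Sphi k : S (phi k) by apply/phiP; exists k.
have /choice[g gP] : forall x : {x | S x}, exists k, phi k = sval x.
  by move=> [x Sx]; exact/phiP.
exists g, (fun k => exist _ (phi k) (Sphi k)) => [[x Sx]|k].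
  by apply: sval_inj; rewrite /= gP.
by apply: phiI; rewrite gP.
Qed.

Lemma copy_of_not_card_lt (K X : Type) (S : X -> Prop) (mu : nat) :
  infinite_type K -> copy_of K S -> ~ card_lt S mu.
Proof.
move=> [e eI] [phi [phiI phiP]] [s [_ sS]].
(* In [card_lt] the default of [nth] is the point itself; here one default serves all [t], which is
   harmless for indices below [size s]. *)
have /choice[r rP] t : exists r : 'I_(size s), phi (e t) = nth (phi (e 0)) s r.
  have [|i si E] := sS (phi (e t)); first by apply/phiP; exists (e t).
  by exists (Ordinal si); rewrite {1}E; apply: set_nth_default.
have rI : injective r by move=> t t' E; apply/eI/phiI; rewrite (rP t) E -(rP t').
have: injective (fun j : 'I_(size s).+1 => r j) by move=> j j' /rI/val_inj.
by move=> /leq_card; rewrite !card_ord ltnn.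
Qed.

Unset Implicit Arguments.

Theorem theorem6p4 (K : Type) (m l : nat) :
  infinite_type K -> 0 < l ->
  wchiCF_sys_ge (beth K m) K (2 * l + 1) ((m + 1) * l + 1).
Proof.
move=> Kinf l0.
have [_ _ [X [A [_ [copyA thinA] hardA]]]] := beth_system m Kinf l0.
exists X, A; split; first (split=> [i j Aij|]; last split).
- apply: contrapT => /thinA/(card_lt_image (g := id)) small.
  apply: (copy_of_not_card_lt Kinf (copyA i)); apply: small => x Aix.
  by exists x; rewrite // -Aij.
- by move=> i; exact: copy_of_equipotent.
- by move=> i j /thinA; rewrite addn1.
move=> k kn [f fCF].
(* Undefined points receive [k], which lies outside [iota 0 k]; the strict bound on [k] gives
   [k <= m.+1 * l]. *)
have [|i iP] := hardA (fun x => if f x is Some z then val z else k) (iota 0 k).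
  by move: kn; rewrite size_iota !addn1 ltnS.
have [z [x [Aix [fx xu]]]] := fCF i.
apply: (iP (val z)); first by rewrite mem_iota /= add0n.
exists x; rewrite fx; split=> //; split=> // y Aiy.
case E: (f y) => [w|] zE; last by move: (ltn_ord z); rewrite -zE ltnn.
by apply: xu => //; rewrite E; congr Some; exact: val_inj.
Qed.
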